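(* Let $\mathcal{S}$ be an algebra (with finitely many operations) that admits a unary FA-presentation. Then every finitely generated subalgebra of $\mathcal{S}$ admits a unary FA-presentation.
   Context: For words $w_1,\dots,w_n$ over a finite alphabet $A$, $\mathrm{conv}(w_1,\dots,w_n)$ is the word over $(A\cup\{\$\})^n$ ($\$$ a new symbol) whose $j$-th letter is the tuple of $j$-th letters of the $w_i$, where shorter words are padded at the end with $\$$. A relation $R\subseteq (A^* )^n$ is regular if $\{\mathrm{conv}(w_1,\dots,w_n):(w_1,\dots,w_n)\in R\}$ is a regular language. An algebra is regarded as a relational structure by replacing each $k$-ary operation $f$ by its graph, the $(k+1)$-ary relation $\{(x_1,\dots,x_k,(x_1,\dots,x_k)f)\}$. An FA-presentation of a relational structure $\mathcal{S}=(S,R_1,\dots,R_n)$ is a pair $(L,\phi)$ with $L$ a regular language over a finite alphabet and $\phi:L\to S$ surjective such that for each $R\in\{=,R_1,\dots,R_n\}$ of arity $r$, the relation $\{(w_1,\dots,w_r)\in L^r: R(w_1\phi,\dots,w_r\phi)\}$ is regular. It is unary if $L$ is a language over a one-letter alphabet. *)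

(* Defs.v *)
From mathcomp Require Import all_boot.

Set Implicit Arguments.
Unset Strict Implicit.
Unset Printing Implicit Defensive.

Definition language (A : Type) := seq A -> Prop.

Record dfa (A : finType) := DFA {
  dfa_state : finType;
  dfa_init : dfa_state;
  dfa_final : pred dfa_state;
  dfa_step : dfa_state -> A -> dfa_state
}.

Definition dfa_accepts (A : finType) (M : dfa A) (w : seq A) : bool :=
  dfa_final (foldl (@dfa_step A M) (dfa_init M) w).

Definition regular (A : finType) (L : language A) : Prop :=
  exists M : dfa A, forall w, L w <-> dfa_accepts M w.

(* [None] plays the role of the padding symbol $. *)
Definition conv (A : Type) (n : nat) (ws : n.-tuple (seq A)) :
    seq (n.-tuple (option A)) :=
  mkseq (fun j => [tuple nth None (map Some (tnth ws i)) j | i < n])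
        (\max_(i < n) size (tnth ws i)).

Definition regular_rel (A : finType) (n : nat)
    (R : n.-tuple (seq A) -> Prop) : Prop :=
  @regular (n.-tuple (option A)) (fun u => exists2 ws, R ws & u = conv ws).

Record rel_structure := RelStructure {
  rs_sort :> Type;
  rs_symbol : finType;
  rs_arity : rs_symbol -> nat;
  rs_rel : forall r : rs_symbol, (rs_arity r).-tuple rs_sort -> Prop
}.

(* The relation on words {(w_1, ..., w_n) in L^n | R (w_1 phi, ..., w_n phi)}. *)
Definition word_rel (A : finType) (L : language A) (X : Type)
    (phi : {w : seq A | L w} -> X) (n : nat) (R : n.-tuple X -> Prop)
    (ws : n.-tuple (seq A)) : Prop :=
  exists2 vs : n.-tuple {w : seq A | L w},
    ws = map_tuple sval vs & R (map_tuple phi vs).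

Definition eq_rel (X : Type) (t : 2.-tuple X) : Prop :=
  tnth t ord0 = tnth t ord_max.

Definition FA_presentation (S : rel_structure) (A : finType) (L : language A)
    (phi : {w : seq A | L w} -> S) : Prop :=
  [/\ regular L,
      forall x : S, exists w, phi w = x,
      regular_rel (word_rel phi (@eq_rel S)) &
      forall r : rs_symbol S, regular_rel (word_rel phi (@rs_rel S r))].

Definition unary_FA_presentable (S : rel_structure) : Prop :=
  exists (A : finType) (L : language A) (phi : {w : seq A | L w} -> S),
    #|A| = 1 /\ FA_presentation phi.

Record algebra := Algebra {
  alg_sort :> Type;
  alg_symbol : finType;
  alg_arity : alg_symbol -> nat;
  alg_op : forall f : alg_symbol, (alg_arity f).-tuple alg_sort -> alg_sort
}.

Definition op_graph (X : Type) (k : nat) (f : k.-tuple X -> X)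
    (t : k.+1.-tuple X) : Prop :=
  exists x : k.-tuple X, t = rcons_tuple x (f x).

Definition rel_structure_of (S : algebra) : rel_structure :=
  @RelStructure S (alg_symbol S) (fun f => (alg_arity f).+1)
    (fun f => op_graph (@alg_op S f)).

Definition op_closed (S : algebra) (T : S -> Prop) : Prop :=
  forall (f : alg_symbol S) (x : (alg_arity f).-tuple S),
    (forall i, T (tnth x i)) -> T (alg_op x).

Record subalgebra (S : algebra) := Subalgebra {
  sub_carrier :> S -> Prop;
  sub_closed : op_closed sub_carrier
}.

Lemma sub_op_subproof (S : algebra) (T : subalgebra S) (f : alg_symbol S)
    (x : (alg_arity f).-tuple {y : S | T y}) : T (alg_op (map_tuple sval x)).
Proof.
by apply: sub_closed => i; rewrite tnth_map; apply: (svalP (tnth x i)).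
Qed.

Definition sub_op (S : algebra) (T : subalgebra S) (f : alg_symbol S)
    (x : (alg_arity f).-tuple {y : S | T y}) : {y : S | T y} :=
  exist _ (alg_op (map_tuple sval x)) (sub_op_subproof x).

(* Since [T] is Prop-valued, [sval] is injective on this carrier only up to proof
   irrelevance; the same holds for the domain {w | L w} of a presentation. *)
Definition algebra_of_sub (S : algebra) (T : subalgebra S) : algebra :=
  @Algebra {y : S | T y} (alg_symbol S) (@alg_arity S) (@sub_op S T).

(* Membership in the least subset of S that contains X and is closed under the
   operations. *)
Definition generated (S : algebra) (X : S -> Prop) (x : S) : Prop :=
  forall U : S -> Prop, op_closed U -> (forall y, X y -> U y) -> U x.

Definition finitely_generated (S : algebra) (T : subalgebra S) : Prop :=
  exists (n : nat) (g : 'I_n -> S),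
    forall x, T x <-> generated (fun y => exists i, y = g i) x.

(* Main.v *)
(** Words over a one-letter alphabet are natural numbers, so a set of words is an
    infinite binary sequence. Being closed under a regular relation is a safety
    property of that sequence: a violation is a tuple of positions, hence shows up
    in a finite prefix, and a finite deterministic monitor detects it by the subset
    construction. The words representing elements of T form the least set that
    contains one word per generator and is closed under the equality relation and
    the operation graphs, so m is not in it iff some safe sequence is false at m.
    Guessing the first m bits of such a sequence and asking whether the monitor
    state reached afterwards can be continued forever is a finite-state test of m.
    Restricting the given presentation to this regular language presents T. *)
Require Import Defs.
From mathcomp Require Import all_boot.
From mathcomp Require Import boolp.

Set Implicit Arguments.
Unset Strict Implicit.
Unset Printing Implicit Defensive.

(** * Safety properties of binary sequences *)

Definition safety (C : (nat -> bool) -> Prop) : Prop :=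
  exists (D : finType) (d0 : D) (step : D -> bool -> D) (bad : pred D),
    (forall d b, bad d -> bad (step d b)) /\
    forall al, C al <-> forall t, ~~ bad (foldl step d0 (mkseq al t)).

Lemma safety_ext (C C' : (nat -> bool) -> Prop) :
  safety C -> (forall al, C al <-> C' al) -> safety C'.
Proof.
move=> [D [d0 [step [bad [bad_step CP]]]]] CC'.
exists D, d0, step, bad; split=> // al.
by rewrite -CC'.
Qed.

Lemma safety_true : safety (fun=> True).
Proof. by exists unit, tt, (fun d _ => d), pred0. Qed.

Lemma safety_and (C1 C2 : (nat -> bool) -> Prop) :
  safety C1 -> safety C2 -> safety (fun al => C1 al /\ C2 al).
Proof.
move=> [D1 [d1 [step1 [bad1 [bs1 C1P]]]]] [D2 [d2 [step2 [bad2 [bs2 C2P]]]]].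
pose step (d : D1 * D2) b := (step1 d.1 b, step2 d.2 b).
have foldE s e : foldl step e s = (foldl step1 e.1 s, foldl step2 e.2 s).
  by elim: s e => [|b s IHs] [e1 e2] //=; rewrite IHs.
exists (D1 * D2)%type, (d1, d2), step, (fun d => bad1 d.1 || bad2 d.2).
split=> [d b /orP[/bs1|/bs2] H|al]; first by rewrite H.
  by rewrite H orbT.
rewrite C1P C2P; split=> [[H1 H2] t|H].
  by rewrite foldE negb_or H1 H2.
by split=> t; have := H t; rewrite foldE negb_or => /andP[].
Qed.

Lemma safety_forall (I : finType) (C : I -> (nat -> bool) -> Prop) :
  (forall i, safety (C i)) -> safety (fun al => forall i, C i al).
Proof.
move=> sC; suff sCs (s : seq I) : safety (fun al => forall i, i \in s -> C i al).
  apply: (safety_ext (sCs (enum I))) => al.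
  by split=> H i *; apply: H; rewrite mem_enum.
elim: s => [|i s IHs]; first exact: (safety_ext safety_true).
apply: (safety_ext (safety_and (sC i) IHs)) => al; split=> [[Ci Cs] j|H].
  by rewrite inE => /predU1P[->|/Cs].
by split=> [|j js]; apply: H; rewrite inE ?eqxx ?js ?orbT.
Qed.

(** The monitor for position [m.+1] spends an extra state [None] on the first bit, then runs the
    monitor for [m] on the shifted sequence. *)
Lemma safety_nth m : safety (fun al => al m).
Proof.
elim: m => [|m [D [d0 [step [bad [bad_step CP]]]]]].
  pose step (d : option bool) b := if d is Some _ then d else Some b.
  exists (option bool), None, step, (pred1 (Some false)).
  have stepS c s : foldl step (Some c) s = Some c by elim: s.
  split=> [[[]|] //|al]; split=> [al0 [|t] //|/(_ 1) /=]; last by case: (al 0).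
  by rewrite /mkseq /= stepS al0.
pose step' (d : option D) b := Some (if d is Some d then step d b else d0).
exists (option D), None, step', (fun d => if d is Some d then bad d else false).
have stepS e s : foldl step' (Some e) s = Some (foldl step e s).
  by elim: s e => [|b s IHs] e //=; apply: IHs.
split=> [[d|] b //|al]; first exact: bad_step.
have fE t : foldl step' None (mkseq al t.+1)
          = Some (foldl step d0 (mkseq (al \o succn) t)).
  by rewrite /mkseq /= -[1]addn0 iotaDl -map_comp stepS.
rewrite (CP (al \o succn)); split=> [H [|t] //|H t]; first by rewrite fE.
by have := H t.+1; rewrite fE.
Qed.

(** * From safety properties to regular languages *)

Lemma mkseqD (T : Type) (f : nat -> T) m n :
  mkseq f (m + n) = mkseq f m ++ mkseq (fun j => f (m + j)) n.
Proof. by rewrite /mkseq iotaD map_cat add0n -{2}[m]addn0 iotaDl -map_comp. Qed.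

(** The state after [w] is the set of monitor states reached by the bit strings of length [size w].
    It is final when none of them can be continued safely forever after a bit [false]. *)
Lemma regular_safety_members (A : finType) (C : (nat -> bool) -> Prop) :
  safety C -> @regular A (fun w => forall al, C al -> al (size w)).
Proof.
move=> [D [d0 [step [bad [bad_step CP]]]]].
pose live d := `[< exists be, forall t, ~~ bad (foldl step d (mkseq be t)) >].
pose next (Q : {set D}) := [set step d b | d in Q, b in predT].
exists (DFA [set d0] (fun Q : {set D} => [forall d in Q, ~~ live (step d false)])
  (fun Q (_ : A) => next Q)) => w.
rewrite /dfa_accepts /=.
have badW s d : bad d -> bad (foldl step d s).
  by elim: s d => //= b s IHs d /(bad_step _ b); apply: IHs.
have reachP d : reflect (exists2 u, size u = size w & d = foldl step d0 u)
                        (d \in foldl (fun Q _ => next Q) [set d0] w).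
  elim/last_ind: w d => [|w a IHw] d /=.
    apply: (iffP set1P) => [->|[u /size0nil-> //]]; by exists [::].
  rewrite foldl_rcons; apply: (iffP imset2P) => [[e b /IHw[u su ->] _ ->]|[u]].
    by exists (rcons u b); rewrite ?foldl_rcons ?size_rcons ?su.
  case/lastP: u => [|u b]; rewrite !size_rcons // => -[su] ->.
  by rewrite foldl_rcons; exists (foldl step d0 u) b => //; apply/IHw; exists u.
split=> [H|/'forall_implyP H al /CP Cal].
  apply/'forall_implyP => d /reachP[u su ->]; apply/negP => /asboolP[be be_ok].
  (* The bits of [u], then [false] at position [size w], then [be], supplied through the default
     value of [nth]. *)
  pose al j := nth (be (j - (size w).+1)) (rcons u false) j.
  have alE t : mkseq al ((size w).+1 + t) = rcons u false ++ mkseq be t.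
    rewrite mkseqD; congr (_ ++ _).
      apply: (@eq_from_nth _ false); first by rewrite size_mkseq size_rcons su.
      move=> i; rewrite size_mkseq => lti; rewrite nth_mkseq // /al.
      by apply: set_nth_default; rewrite size_rcons su.
    apply: eq_map => j /=.
    by rewrite /al nth_default ?size_rcons ?su ?leq_addr // addKn.
  (* Badness persists, so it suffices to check the longer prefixes described by [alE]. *)
  have : al (size w) by apply: H; apply/CP => t;
    apply: contra (be_ok t) => /(badW (mkseq (fun j => al (t + j)) (size w).+1));
    rewrite -foldl_cat -mkseqD addnC alE foldl_cat foldl_rcons.
  by rewrite /al nth_rcons su ltnn eqxx.
apply: contraT => /negbTE al0.
have /H/negP[] : foldl step d0 (mkseq al (size w))
    \in foldl (fun Q _ => next Q) [set d0] w.
  by apply/reachP; exists (mkseq al (size w)); rewrite ?size_mkseq.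
apply/asboolP; exists (fun j => al ((size w).+1 + j)) => t.
have := Cal ((size w).+1 + t).
by rewrite mkseqD foldl_cat mkseqS foldl_rcons al0.
Qed.

(** * Convolutions and restriction of regular relations *)

Lemma pmap_map (A B C : Type) (f : B -> option C) (g : A -> B) s :
  pmap f (map g s) = pmap (f \o g) s.
Proof. by elim: s => //= a s ->. Qed.

(** Track [i] is the word followed by padding, which [pmap] discards. *)
Lemma pmap_conv (A : Type) (n : nat) (ws : n.-tuple (seq A)) i :
  pmap (fun x : n.-tuple (option A) => tnth x i) (conv ws) = tnth ws i.
Proof.
rewrite /conv pmap_map; set m := \max_(_ < n) _.
rewrite (@eq_pmap _ _ _ (nth None (map Some (tnth ws i)))); last first.
  by move=> j; rewrite /= tnth_mktuple.
have : size (tnth ws i) <= m by exact: (@leq_bigmax _ (fun i => size (tnth ws i)) i).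
elim: (tnth ws i) m => [|a w IHw] [|m] //= => [_|].
  by elim: (iota 1 m) => //= j s ->; rewrite nth_nil.
by rewrite ltnS -[1]addn0 iotaDl pmap_map => /IHw->.
Qed.

Lemma conv_inj (A : Type) (n : nat) : injective (@conv A n).
Proof. by move=> u v uv; apply: eq_from_tnth => i; rewrite -!pmap_conv uv. Qed.

(** [M] runs in parallel with one copy of [N] per track; padding leaves the state of that copy
    unchanged. *)
Lemma regular_rel_restrict (A : finType) (n : nat) (L : language A)
    (R : n.-tuple (seq A) -> Prop) :
  regular L -> regular_rel R ->
  regular_rel (fun ws => R ws /\ forall i, L (tnth ws i)).
Proof.
move=> [N NP] [M MP].
pose stepN (q : dfa_state N) x := if x is Some a then dfa_step q a else q.
have stepNE q s i : foldl stepN q [seq tnth x i | x <- s]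
    = foldl (@dfa_step A N) q (pmap (fun x : n.-tuple (option A) => tnth x i) s).
  by elim: s q => //= x s IHs q; rewrite IHs; case: (tnth x i).
pose step (p : dfa_state M * {ffun 'I_n -> dfa_state N}) x :=
  (dfa_step p.1 x, [ffun i => stepN (p.2 i) (tnth x i)]).
have stepE p s : foldl step p s = (foldl (@dfa_step _ M) p.1 s,
    [ffun i => foldl stepN (p.2 i) [seq tnth x i | x <- s]]).
  elim: s p => [|x s IHs] [q f] /=; first by congr pair; apply/ffunP => i; rewrite ffunE.
  by rewrite IHs; congr pair; apply/ffunP => i; rewrite !ffunE.
exists (DFA (dfa_init M, [ffun=> dfa_init N])
  (fun p => dfa_final p.1 && [forall i, dfa_final (p.2 i)]) step) => u.
rewrite /dfa_accepts /= stepE /=.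
split=> [[ws [Rws Lws] ->]|/andP[Mu /forallP Nu]].
  apply/andP; split; first by apply/MP; exists ws.
  by apply/forallP => i; rewrite !ffunE stepNE pmap_conv; apply/NP.
have [ws Rws uE] := (MP u).2 Mu; exists ws => //; split=> // i; apply/NP.
by have := Nu i; rewrite !ffunE stepNE uE pmap_conv.
Qed.

(** * Closure under a regular relation as a safety property *)

Lemma all_equal_to_nseq (A : eqType) (a : A) :
  all_equal_to a -> forall w : seq A, w = nseq (size w) a.
Proof. by move=> aP w; apply/all_pred1P/allP => b _; rewrite /= aP. Qed.

(** [al] encodes a set of words by their lengths, which loses nothing over a one-letter alphabet;
    [o] is the output coordinate. *)
Definition closed_under (A : Type) (n : nat) (o : 'I_n)
    (R : n.-tuple (seq A) -> Prop) (al : nat -> bool) : Prop :=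
  forall ws, R ws -> (forall i, i != o -> al (size (tnth ws i))) ->
  al (size (tnth ws o)).

(** The monitor guesses where each word of a violating tuple ends. These guesses determine the
    letters of the convolution, on which [M] is simulated; following all guesses at once makes the
    monitor deterministic. *)
Lemma safety_closed_under (A : finType) (n : nat) (o : 'I_n)
    (R : n.-tuple (seq A) -> Prop) :
  #|A| = 1 -> regular_rel R -> safety (closed_under o R).
Proof.
move=> /fintype1[a0 /all_equal_to_nseq nseqE] [M MP].
have RE ws : R ws <-> dfa_accepts M (conv ws).
  by rewrite -MP; split=> [|[ws' R' /conv_inj->//]]; exists ws.
(* Track [i] is padded at [j] exactly when [ms i <= j], so the letter at [j] comes from
   [ended ms j.+1]. *)
pose ended (ms : 'I_n -> nat) t := [set i | ms i < t].
pose letter (S : {set 'I_n}) := [tuple if i \in S then None else Some a0 | i < n].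
(* Reading stops at the length of the convolution, so that acceptance persists. *)
pose stepM q (S : {set 'I_n}) := if S == setT then q else dfa_step (d := M) q (letter S).
pose run ms t := foldl stepM (dfa_init M) (mkseq (fun j => ended ms j.+1) t).
have runS ms t : run ms t.+1 = stepM (run ms t) (ended ms t.+1).
  by rewrite /run mkseqS foldl_rcons.
have endedT ms t : (ended ms t.+1 == setT) = (\max_(i < n) ms i <= t).
  apply/eqP/bigmax_leqP => [E i _|H]; first by have := in_setT i; rewrite -E inE.
  by apply/setP => i; rewrite !inE ltnS H.
have runE ms t : run ms t = foldl (@dfa_step _ M) (dfa_init M)
    (mkseq (fun j => letter (ended ms j.+1)) (minn t (\max_(i < n) ms i))).
  elim: t => [|t IHt]; first by rewrite min0n.
  rewrite runS IHt /stepM endedT; case: leqP => [le|lt].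
    by rewrite !(minn_idPr _) // ltnW.
  by rewrite !(minn_idPl _) // ?(ltnW lt) // mkseqS foldl_rcons.
have convE ws : conv ws = mkseq (fun j => letter (ended (fun i => size (tnth ws i)) j.+1))
    (\max_(i < n) size (tnth ws i)).
  apply: eq_map => j; apply: eq_from_tnth => i; rewrite !tnth_mktuple inE ltnS.
  rewrite {1}(nseqE (tnth ws i)) map_nseq nth_nseq.
  by case: leqP.
(* A configuration guesses positions [ms]: it stores the indices [i] with [ms i]
   already read, and the state of [M]. Each position must be true, except that
   of [o], which must be false. *)
pose config := ({set 'I_n} * dfa_state M)%type.
pose step (d : {set config}) (b : bool) : {set config} :=
  [set p' : config | [exists p : config in d, [&& p.1 \subset p'.1, [forall i in p'.1 :\: p.1, b == (i != o)]
    & p'.2 == stepM p.2 p'.1]]].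
pose ok al ms t := forall i, ms i < t -> al (ms i) = (i != o).
have stepP al t p : p \in foldl step [set (set0, dfa_init M)] (mkseq al t) <->
    exists ms, [/\ ok al ms t, p.1 = ended ms t & p.2 = run ms t].
  elim: t p => [|t IHt] [S q].
    rewrite inE; split=> [/eqP[-> ->]|[ms [_ /= -> ->]]].
      by exists (fun=> 0); split=> //; apply/setP => i; rewrite !inE.
    by apply/eqP; congr pair; apply/setP => i; rewrite !inE.
  rewrite mkseqS foldl_rcons inE; split=> /=.
    move=> /existsP[[S0 q0] /and4P[/IHt[ms [/= okms -> ->]] sub /'forall_implyP new /eqP->]].
    (* Positions not yet read at [t.+1] are arbitrary beyond [t]. *)
    pose ms' i := if i \in ended ms t then ms i else if i \in S then t else t.+1.
    have endE j : j <= t -> ended ms' j = ended ms j.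
      move=> le; apply/setP => i; rewrite !inE /ms' inE.
      case: (ltnP (ms i) t) => // le'; rewrite [ms i < j]ltnNge (leq_trans le le') /=.
      by case: ifP => _; rewrite ltnNge ?le // ltnW.
    have SE : S = ended ms' t.+1.
      apply/setP => i; rewrite inE /ms'.
      case: ifP => [iS|_]; last by case: (i \in S); rewrite ?ltnSn ?ltnn.
      by rewrite (subsetP sub) //; move: iS; rewrite inE => /ltnW; rewrite ltnS.
    exists ms'; split=> //.
      move=> i; rewrite /ms'; case: ifP => [|/negbT iN].
        by rewrite inE => lti _; apply: okms.
      case: ifP => [iS _|_]; last by rewrite ltnn.
      by apply/eqP/new; rewrite inE iN.
    rewrite runS -SE; congr stepM; rewrite /run; congr foldl.
    by apply/esym/eq_in_map => j; rewrite mem_iota => /= lt; apply: endE.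
  move=> [ms [okms -> ->]]; apply/existsP; exists (ended ms t, run ms t).
  apply/and4P; split=> //=.
  - by apply/IHt; exists ms; split=> // i lti; apply: okms; apply: ltnW.
  - by apply/subsetP => i; rewrite !inE => /ltnW.
  - apply/'forall_implyP => i; rewrite !inE -leqNgt ltnS => /andP[le1 le2].
    have {le1 le2} E : ms i = t by apply/eqP; rewrite eqn_leq le1 le2.
    by rewrite -okms E.
  - by rewrite runS.
exists {set config}, [set (set0, dfa_init M)], step,
  (fun d : {set config} => [exists q, dfa_final q && ((setT, q) \in d)]).
(* Since [stepM] is frozen at [setT], the configuration [(setT, q)] succeeds itself on either
   bit. *)
split=> [d b /existsP[q /andP[fq qd]]|al].
  apply/existsP; exists q; rewrite fq inE /=; apply/existsP; exists (setT, q).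
  by rewrite qd subxx setDv /stepM eqxx /= eqxx andbT; apply/'forall_implyP => i; rewrite inE.
split=> [Cal t|H ws /RE Mws Hws].
  apply/existsP => -[q /andP[fq /stepP[ms [/= okms Et qE]]]].
  pose ws := [tuple nseq (ms i) a0 | i < n].
  have wsE i : size (tnth ws i) = ms i by rewrite tnth_mktuple size_nseq.
  have ltt i : ms i < t by have := in_setT i; rewrite Et inE.
  have : al (size (tnth ws o)).
    apply: Cal => [|i io]; last by rewrite wsE okms.
    apply/RE; rewrite /dfa_accepts convE.
    have -> : (fun i => size (tnth ws i)) = ms by apply/funext.
    have mE : \max_(i < n) size (tnth ws i) = \max_(i < n) ms i by apply: eq_bigr.
    move: fq; rewrite qE runE mE (minn_idPr _) //.
    by apply/bigmax_leqP => i _; apply: ltnW.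
  by rewrite wsE okms // eqxx.
apply: contraT => alo; pose ms i := size (tnth ws i).
(* The successor is needed for the bit at the largest position to have been read. *)
case/existsP: (H (\max_(i < n) ms i).+1); exists (run ms (\max_(i < n) ms i).+1).
apply/andP; split.
  by rewrite runE (minn_idPr _) // -convE.
apply/stepP; exists ms; split=> //=; last by apply/esym/eqP; rewrite endedT.
by move=> i _; case: eqP => [->|/eqP/Hws//]; apply/negbTE.
Qed.

(** * The restricted presentation of the subalgebra *)

Lemma tnth_rcons_max (X : Type) (k : nat) (t : k.-tuple X) x :
  tnth (rcons_tuple t x) ord_max = x.
Proof. by rewrite (tnth_nth x) nth_rcons size_tuple ltnn eqxx. Qed.

Lemma tnth_rcons_lift (X : Type) (k : nat) (t : k.-tuple X) x i :
  tnth (rcons_tuple t x) (lift ord_max i) = tnth t i.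
Proof.
by rewrite !(tnth_nth x) nth_rcons size_tuple lift_max ltn_ord.
Qed.

Lemma sval_inj (X : Type) (P : X -> Prop) : injective (@sval X P).
Proof. by move=> [x Px] [y Py] /= xy; apply: eq_exist. Qed.

(** For the converse, the arguments are the initial entries of [t], which already carry proofs of
    membership in [T]. *)
Lemma op_graph_sub (S : algebra) (T : subalgebra S) (f : alg_symbol S)
    (t : (alg_arity f).+1.-tuple {y : S | T y}) :
  op_graph (@sub_op S T f) t <-> op_graph (@alg_op S f) (map_tuple sval t).
Proof.
split=> [[x ->]|[x tE]].
  by exists (map_tuple sval x); apply: val_inj; rewrite /= map_rcons.
have svE i : sval (tnth t i) = tnth (rcons_tuple x (alg_op x)) i.
  by rewrite -tE tnth_map.
pose x' := [tuple tnth t (lift ord_max i) | i < alg_arity f].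
have xE : x = map_tuple sval x'.
  apply: eq_from_tnth => i.
  by rewrite tnth_map tnth_mktuple svE tnth_rcons_lift.
exists x'; apply: eq_from_tnth => i; case: (unliftP ord_max i) => [j|] ->.
  by rewrite tnth_rcons_lift tnth_mktuple.
rewrite tnth_rcons_max; apply: sval_inj.
by rewrite svE tnth_rcons_max xE.
Qed.

Theorem theorem5p2 (S : algebra) (T : subalgebra S) :
  unary_FA_presentable (rel_structure_of S) ->
  finitely_generated T ->
  unary_FA_presentable (rel_structure_of (algebra_of_sub T)).
Proof.
move=> [A [L [phi [A1 [regL surj regE regF]]]]] [n [g Tg]].
(* [phi] takes a word with a proof of [L w]; the choice of proof is immaterial by proof irrelevance,
   whence [L'E]. *)
pose L' w := L w /\ forall Lw : L w, T (phi (exist _ w Lw)).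
have L'E v : L' (sval v) <-> T (phi v).
  case: v => w Lw; split=> [[_]|Tw]; first exact.
  by split=> // Lw'; rewrite (Prop_irrelevance Lw' Lw).
pose inL (v : {w | L' w}) : {w | L w} := exist _ (sval v) (proj1 (svalP v)).
pose phi' (v : {w | L' w}) : {y : S | T y} :=
  exist _ (phi (inL v)) (proj2 (svalP v) _).
have regL' : regular L'.
  have [gw gwE] := fin_all_exists (fun i => surj (g i)).
  pose C (al : nat -> bool) := (forall i, al (size (sval (gw i)))) /\
    (closed_under ord_max (word_rel phi (@eq_rel S)) al /\
     forall f, closed_under ord_max (word_rel phi (op_graph (@alg_op S f))) al).
  have /(@regular_safety_members A) [M MP] : safety C.
    apply: safety_and; first by apply: safety_forall => i; apply: safety_nth.
    apply: safety_and; first exact: safety_closed_under.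
    by apply: safety_forall => f; apply: safety_closed_under A1 (regF f).
  exists M => w; rewrite -MP; split=> [[Lw /(_ Lw)/Tg gen_w] al [Cg [Ce Cf]]|H].
    (* Induction on generation, for all representatives of [y] at once. The operation graphs handle
       any representative of a value; for a generator, the equality relation links it to the chosen
       [gw i]. *)
    apply: (gen_w (fun y => forall v, phi v = y -> al (size (sval v))) _ _
      (exist _ w Lw)) => // [f x Ux v vE|y [i ->] v vE].
      have [vs vsE] := fin_all_exists (fun i => surj (tnth x i)).
      pose ws := rcons_tuple [tuple vs i | i < alg_arity f] v.
      have := Cf f (map_tuple sval ws).
      rewrite [tnth _ ord_max]tnth_map tnth_rcons_max; apply.
        exists ws => //; exists x; apply: eq_from_tnth => i; rewrite tnth_map.
        case: (unliftP ord_max i) => [j|] ->; last by rewrite !tnth_rcons_max.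
        by rewrite !tnth_rcons_lift tnth_mktuple.
      move=> i; case: (unliftP ord_max i) => [j|] ->; last by rewrite eqxx.
      rewrite tnth_map tnth_rcons_lift tnth_mktuple => _.
      exact: (Ux j).
    apply: (Ce [tuple sval (gw i); sval v]) => [|j].
      exists [tuple gw i; v]; first exact: val_inj.
      by rewrite /eq_rel !tnth_map !(tnth_nth v) /= gwE vE.
    case: (unliftP ord_max j) => [k|] ->; last by rewrite eqxx.
    by rewrite ord1 => _; apply: Cg.
  have [a0 /all_equal_to_nseq nseqE] := fintype1 A1.
  (* Conversely, the set of lengths of words in [L'] itself satisfies [C]. *)
  rewrite (nseqE w); apply/asboolP; apply: (H (fun m => `[< L' (nseq m a0) >])).
  split; [|split] => [i|ws [vs -> vsE]|f ws [vs -> [x vsE]]].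
  - apply/asboolP; rewrite -nseqE; apply/L'E; rewrite gwE.
    by apply/Tg => U _; apply; exists i.
  - move=> /(_ ord0 isT)/asboolP; rewrite -nseqE tnth_map => /L'E T0.
    apply/asboolP; rewrite -nseqE tnth_map; apply/L'E.
    by move: vsE; rewrite /eq_rel !tnth_map => <-.
  - have phiE i : phi (tnth vs i) = tnth (rcons_tuple x (alg_op x)) i.
      by rewrite -vsE tnth_map.
    move=> H'; apply/asboolP; rewrite -nseqE tnth_map; apply/L'E.
    rewrite phiE tnth_rcons_max; apply: sub_closed => i.
    have := H' (lift ord_max i); rewrite eq_sym neq_lift => /(_ isT)/asboolP.
    by rewrite -nseqE tnth_map => /L'E; rewrite phiE tnth_rcons_lift.
(* The word relation of [R'] under [phi'] is that of [R] under [phi], restricted to tuples of words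
   in [L']. *)
have reg_rel m (R : m.-tuple S -> Prop) (R' : m.-tuple {y : S | T y} -> Prop) :
    (forall t, R' t <-> R (map_tuple sval t)) ->
    regular_rel (word_rel phi R) -> regular_rel (word_rel phi' R').
  move=> RR' /(regular_rel_restrict regL').
  congr regular_rel; apply/funext => ws; apply/propext; split.
    move=> [[vs wsE Rvs] L'ws].
    pose vs' := [tuple exist _ (tnth ws i) (L'ws i) | i < m].
    exists vs'; first by apply: eq_from_tnth => i; rewrite tnth_map tnth_mktuple.
    apply/RR'; move: Rvs; congr R; apply: eq_from_tnth => i.
    rewrite (tnth_map phi) (tnth_map sval) (tnth_map phi') tnth_mktuple /=.
    congr phi; apply: sval_inj.
    by rewrite /= wsE tnth_map.
  move=> [vs -> /RR' Rvs]; split=> [|i]; last by rewrite tnth_map; apply: svalP.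
  exists (map_tuple inL vs); first by apply: val_inj; rewrite /= -map_comp.
  by move: Rvs; congr R; apply: val_inj; rewrite /= -!map_comp.
exists A, L', phi'; split=> //; split=> //.
- move=> [y Ty]; have [v vE] := surj y.
  have L'v : L' (sval v) by apply/L'E; rewrite vE.
  exists (exist _ (sval v) L'v); apply: sval_inj; rewrite /= -vE.
  by congr phi; apply: sval_inj.
- apply: reg_rel regE => t; rewrite /eq_rel !tnth_map.
  by split=> [->//|]; apply: sval_inj.
- by move=> f; apply: reg_rel (regF f) => t; apply: op_graph_sub.
Qed.
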